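(* Let $\Gamma$ be a metric graph and $G$ be a combinatorial model for $\Gamma$. Fix a spanning tree $\mathrm{ST}$ for $G$, and order the edges in $E(G)$ such that the first $n_G-1$ edges correspond to $\mathrm{ST}$. Let $\mathbf V$ and $\mathbf Q$ be the corresponding matrices for $G$. Subdivide an edge $e_j\in E(G)$ into two edges and let $G'$ be the induced combinatorial model. Suppose the new vertex is a $\theta$-percentile point of $e_j$ and is indexed by $n_G+1$ in $V(G')$. Let $\widetilde{\mathbf V}$ and $\widetilde{\mathbf Q}$ be the output, for $G'$, of the matrix algorithm described in the context. Then $\widetilde{\mathbf Q}=\mathbf Q$, and: (i) If $e_j\in\mathrm{ST}$, let $j_-,j_+$ be the indices of the endpoints of $e_j$. Then $\widetilde{\mathbf V}[:,i]=\mathbf V[:,i]$ for $i=1,\dots,n_G$, and $$\widetilde{\mathbf V}[:,n_G+1]=(1-\theta)\mathbf V[:,j_-]+\theta\,\mathbf V[:,j_+].$$ (ii) If $e_j\notin\mathrm{ST}$, let $\mathbf w\in\mathbb R^g$ be the column vector whose only nonzero entry is $\mathbf w[j-n_G+1]=\ell(e_j)$. Then $\widetilde{\mathbf V}[:,i]=\mathbf V[:,i]$ for $i=1,\dots,n_G$, and either $$\widetilde{\mathbf V}[:,n_G+1]=\mathbf V[:,j_-]+\theta\,\mathbf w,$$ or $$\widetilde{\mathbf V}[:,n_G+1]=\mathbf V[:,j_+]-(1-\theta)\mathbf w,$$ depending on which new edge is added to the spanning tree in $G'$.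
   Context: Graphs. A combinatorial graph $G$ is a finite directed multigraph (loops and multiple edges allowed) with vertex set $V(G)$ and edge multiset $E(G)$; each edge $e$ has an initial vertex $e_-$ and a terminal vertex $e_+$. A metric graph $\Gamma$ is a compact topological graph with a length metric. A combinatorial model of $\Gamma$ is a combinatorial graph $G$ with edge lengths $\ell:E(G)\to\mathbb R_{>0}$ such that gluing intervals $[0,\ell(e)]$ along the vertices yields $\Gamma$ isometrically. All graphs are connected and every point has valence at least $2$. Put $n_G=|V(G)|$, $m_G=|E(G)|$, and genus $g=m_G-n_G+1$. For an edge $e_j$, $j_-$ and $j_+$ denote the indices of its initial and terminal vertices. The matrix algorithm. Input: the list of vertices $p_1,\dots,p_n$, the list of edges, and the list of edge lengths of a combinatorial graph. The edges are sorted so that the first $n-1$ of them, $e_1,\dots,e_{n-1}$, form a spanning tree $\mathrm{ST}$, rooted at $p_1$. For $1\le i\le g$ the edge $e_{n-1+i}$ outside $\mathrm{ST}$ determines the $i$-th fundamental 1-cycle $\sigma_i$, consisting of $e_{n-1+i}$ followed by the path in $\mathrm{ST}$ from its terminal to its initial vertex. For each vertex $p_i$, $\gamma_i$ is the unique path in $\mathrm{ST}$ from $p_1$ to $p_i$. For a 1-chain $\alpha$, $\alpha(e)$ is its coefficient at $e$. Put $\mathbf C[i,k]=\sigma_i(e_k)$ (cycle-edge incidence matrix, $g\times m$), $\mathbf Y[i,k]=\gamma_i(e_k)$ (path-edge incidence matrix, $n\times m$), and $\mathbf L=\mathrm{diag}(\ell(e_1),\dots,\ell(e_m))$. The output is $$\mathbf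 V=\mathbf C\mathbf L\mathbf Y^\top\in\mathbb R^{g\times n},\qquad \mathbf Q=\mathbf C\mathbf L\mathbf C^\top\in\mathbb R^{g\times g}.$$ $\mathbf V[:,i]$ is the $i$-th column of $\mathbf V$. The matrices $\mathbf V,\mathbf Q$ for $G$ are these matrices for the fixed tree $\mathrm{ST}$ and edge order. Percentile points. For $0<\theta<1$, a point $p$ in the interior of an edge $e$ is a $\theta$-percentile point of $e$ if $d(e_-,p)=\theta\, d(e_-,e_+)=\theta\,\ell(e)$. *)

(* Defs.v *)
From HB Require Import structures.
From mathcomp Require Import all_boot all_order all_algebra.
From mathcomp Require Import boolp classical_sets reals topology.
Set Implicit Arguments.
Unset Strict Implicit.
Unset Printing Implicit Defensive.
Import Order.TTheory GRing.Theory Num.Theory.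
Local Open Scope ring_scope.

(** * Combinatorial graphs: finite directed multigraphs *)

Record digraph (V E : finType) := Digraph { edge_tail : E -> V; edge_head : E -> V }.

Section Walks.
Variables (V E : finType) (G : digraph V E).

(* Graphs are directed, but paths may traverse edges backwards: the step
   (e, true) goes from edge_tail e to edge_head e, the step (e, false) the other way. *)
Definition step_src (s : E * bool) : V := if s.2 then edge_tail G s.1 else edge_head G s.1.
Definition step_dst (s : E * bool) : V := if s.2 then edge_head G s.1 else edge_tail G s.1.

Fixpoint walk (T : {set E}) (u : V) (w : seq (E * bool)) (v : V) : bool :=
  if w is s :: w' then
    [&& s.1 \in T, step_src s == u & walk T (step_dst s) w' v]
  else u == v.

Definition simple_path (T : {set E}) (u : V) (w : seq (E * bool)) (v : V) : bool :=
  walk T u w v && uniq (u :: map step_dst w).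

(* Distinctness of the edges excludes going back and forth along one edge;
   a loop is a cycle of length 1, two parallel edges form one of length 2. *)
Definition simple_cycle (T : {set E}) (u : V) (w : seq (E * bool)) : bool :=
  [&& walk T u w u, w != [::], uniq (map fst w) & uniq (map step_dst w)].

Definition spans (T : {set E}) : Prop := forall u v, exists w, walk T u w v.

Definition acyclic (T : {set E}) : Prop := forall u w, ~~ simple_cycle T u w.

Definition connected_graph : Prop := spans [set: E]%SET.

Definition spanning_tree (T : {set E}) : Prop := spans T /\ acyclic T.

(* A loop counts twice. *)
Definition valence (v : V) : nat :=
  (#|[pred e | edge_tail G e == v]| + #|[pred e | edge_head G e == v]|)%N.

(* The path in T from u to v; it exists and is unique when T is a spanning
   tree, and the value [::] is a dummy otherwise. *)
Definition tree_path (T : {set E}) (u v : V) : seq (E * bool) :=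
  xget [::] (fun w => simple_path T u w v : Prop).

End Walks.

(** * The matrix algorithm *)

Section MatrixAlgorithm.
Variables (R : realType) (V E : finType) (G : digraph V E) (len : E -> R).

(* vs and es list the vertices and the edges.  With k.+1 vertices and genus g
   there are k + g edges, since g = m - n + 1; the first k of them form the
   tree, and es (rshift k i) is the edge defining the i-th fundamental cycle. *)
Variables (k g : nat) (vs : 'I_k.+1 -> V) (es : 'I_(k + g) -> E).

Definition tree_edges : {set E} := [set es (lshift g i) | i in 'I_k]%SET.

Definition coef (w : seq (E * bool)) (e : E) : R :=
  \sum_(s <- w | s.1 == e) (if s.2 then 1 else -1).

Definition fund_cycle (i : 'I_g) : seq (E * bool) :=
  let e := es (rshift k i) in
  (e, true) :: tree_path G tree_edges (edge_head G e) (edge_tail G e).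

Definition root_path (i : 'I_k.+1) : seq (E * bool) :=
  tree_path G tree_edges (vs ord0) (vs i).

Definition Cmx : 'M[R]_(g, k + g) := \matrix_(i, a) coef (fund_cycle i) (es a).
Definition Ymx : 'M[R]_(k.+1, k + g) := \matrix_(i, a) coef (root_path i) (es a).
Definition Lmx : 'M[R]_(k + g) := diag_mx (\row_a len (es a)).

Definition Vmx : 'M[R]_(g, k.+1) := Cmx *m Lmx *m Ymx^T.
Definition Qmx : 'M[R]_g := Cmx *m Lmx *m Cmx^T.

End MatrixAlgorithm.

(** * Metric graphs and their combinatorial models *)

Section Gluing.
Variables (R : realType) (V E : finType) (G : digraph V E) (len : E -> R).

(* The pair (e, s) is the point at position s of the interval [0, len e]. *)
Definition at_vertex (x : E * R) (v : V) : Prop :=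
  (x.2 = 0 /\ edge_tail G x.1 = v) \/ (x.2 = len x.1 /\ edge_head G x.1 = v).

(* chain x y r: one can go from x to y along finitely many segments of edge
   intervals of total length r, jumping between glued endpoints. *)
Inductive chain : E * R -> E * R -> R -> Prop :=
| chain_refl x : chain x x 0
| chain_segment e s t y r :
    0 <= s <= len e -> 0 <= t <= len e ->
    chain (e, t) y r -> chain (e, s) y (`|s - t| + r)
| chain_glue x y z r v :
    at_vertex x v -> at_vertex y v -> chain y z r -> chain x z r.

Definition glued_dist (x y : E * R) : R := inf (fun r => chain x y r).

End Gluing.

(* A combinatorial model of the metric graph Gam: gluing the intervals
   [0, len e] along the vertices yields Gam isometrically, with chart e s the
   image of the point at position s of e, and vpt v that of the vertex v.  In
   particular Gam is a compact length space. *)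
Record model (R : realType) (Gam : metricType R) (V E : finType) := Model {
  mgraph :> digraph V E;
  len : E -> R;
  vpt : V -> Gam;
  chart : E -> R -> Gam;
  len_gt0 : forall e, 0 < len e;
  mgraph_connected : connected_graph mgraph;
  mgraph_valence : forall v, (2 <= valence mgraph v)%N;
  chart_tail : forall e, chart e 0 = vpt (edge_tail mgraph e);
  chart_head : forall e, chart e (len e) = vpt (edge_head mgraph e);
  chart_surj : forall p, exists e s, 0 <= s <= len e /\ chart e s = p;
  chart_isom : forall e s f t, 0 <= s <= len e -> 0 <= t <= len f ->
    mdist (chart e s) (chart f t) = glued_dist mgraph len (e, s) (f, t)
}.

(* The distance to the initial vertex is measured along the edge, in
   [0, len e]; the distance of Gam can be smaller, for instance on a loop. *)
Definition percentile_point (R : realType) (Gam : metricType R) (V E : finType)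
    (M : model Gam V E) (e : E) (theta : R) (p : Gam) : Prop :=
  exists s, [/\ 0 < s < len M e, p = chart M e s & s = theta * len M e].

(** * Subdividing an edge *)

(* In the graph obtained by subdividing j, None is the new vertex, Some j is
   the half of j from its initial vertex to None, None is the half of j from
   None to its terminal vertex, and Some e is the edge e for e != j. *)
Section Subdivide.
Variables (R : realType) (Gam : metricType R) (V E : finType).
Variables (M : model Gam V E) (j : E) (t : R) (ht : 0 < t < len M j).

Definition sub_graph : digraph (option V) (option E) := Digraph
  (fun e' => omap (edge_tail M) e')
  (fun e' => if e' is Some e then (if e == j then None else Some (edge_head M e))
             else Some (edge_head M j)).

Definition sub_len (e' : option E) : R :=
  if e' is Some e then (if e == j then t else len M e) else len M j - t.

Definition sub_vpt (v' : option V) : Gam :=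
  if v' is Some v then vpt M v else chart M j t.

Definition sub_chart (e' : option E) (s : R) : Gam :=
  if e' is Some e then chart M e s else chart M j (t + s).

Lemma sub_len_gt0 e' : 0 < sub_len e'.
Proof.
have /andP[t0 tl] := ht.
by case: e' => [e|] /=; [case: ifP => _ //; exact: len_gt0 | rewrite subr_gt0].
Qed.

Lemma walk_cat (V' E' : finType) (G : digraph V' E') T u w1 v w2 z :
  walk G T u w1 v -> walk G T v w2 z -> walk G T u (w1 ++ w2) z.
Proof.
elim: w1 u => [|s w1 IH] u /=; first by move/eqP=> ->.
by case/and3P=> -> -> h1 h2 /=; exact: IH.
Qed.

Lemma sub_connected : connected_graph sub_graph.
Proof.
have lift u w v : walk M [set: E]%SET u w v -> exists w', walk sub_graph [set: option E]%SET (Some u) w' (Some v).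
  elim: w u => [|[e b] w IH] u /=; first by move/eqP=> ->; exists [::] => /=.
  case/and3P=> _ /eqP <- /IH[w' hw'].
  have [ej|ej] := eqVneq e j.
    subst e; case: b hw'; rewrite /step_src /step_dst /= => hw'.
      by exists [:: (Some j, true), (None, true) & w']; rewrite /= !inE /step_src /step_dst /= !eqxx.
    by exists [:: (None, false), (Some j, false) & w']; rewrite /= !inE /step_src /step_dst /= !eqxx.
  exists ((Some e, b) :: w'); rewrite /= inE /=.
  by case: b hw'; rewrite /step_src /step_dst /= ?(negPf ej) eqxx.
have conn := @mgraph_connected _ _ _ _ M.
have toS u : exists v w, walk sub_graph [set: option E]%SET u w (Some v).
  case: u => [u|]; first by exists u, [::] => /=.
  exists (edge_tail M j), [:: (Some j, false)].
  by rewrite /= inE /step_src /step_dst /= !eqxx.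
move=> u [v|].
  have [a [w hw]] := toS u; have [w1 /lift[w2 hw2]] := conn a v.
  by exists (w ++ w2); exact: walk_cat hw hw2.
have [a [w hw]] := toS u; have [w1 /lift[w2 hw2]] := conn a (edge_tail M j).
exists ((w ++ w2) ++ [:: (Some j, true)]); apply: walk_cat (walk_cat hw hw2) _.
by rewrite /= inE /step_src /step_dst /= !eqxx.
Qed.

Lemma sub_valence v' : (2 <= valence sub_graph v')%N.
Proof.
case: v' => [v|]; rewrite /valence.
  apply: leq_trans (mgraph_valence M v) _; apply: leq_add.
    rewrite -(card_imset _ (@Some_inj _ : injective (@Some E))); apply: subset_leq_card.
    by apply/fintype.subsetP => _ /imsetP[e he ->]; rewrite !inE in he *; rewrite /= (eqP he).
  pose f e := if e == j then None else Some e.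
  have finj : injective f.
    by move=> a b; rewrite /f; do 2!case: eqVneq => // ?; try congruence; case.
  rewrite -(card_imset _ finj); apply: subset_leq_card.
  apply/fintype.subsetP => _ /imsetP[e he ->]; rewrite !inE in he *.
  by rewrite /f; case: (eqVneq e j) he => [->|ej] /= /eqP he; rewrite ?(negPf ej) he.
apply: (@leq_add 1 1); apply/card_gt0P; [exists None|exists (Some j)]; rewrite inE //=.
by rewrite eqxx.
Qed.

Lemma sub_chart_tail e' : sub_chart e' 0 = sub_vpt (edge_tail sub_graph e').
Proof. by case: e' => [e|] /=; rewrite ?addr0 ?chart_tail. Qed.

Lemma sub_chart_head e' :
  sub_chart e' (sub_len e') = sub_vpt (edge_head sub_graph e').
Proof.
case: e' => [e|] /=; last by rewrite subrKC chart_head.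
by case: eqVneq => [->|_] //; rewrite chart_head.
Qed.

Lemma sub_chart_surj p : exists e' s, 0 <= s <= sub_len e' /\ sub_chart e' s = p.
Proof.
have [e [s [/andP[s0 sl] <-]]] := chart_surj M p.
have [ej|ej] := eqVneq e j; last first.
  by exists (Some e), s; rewrite /= (negPf ej) s0 sl.
subst e; have [st|st] := leP s t.
  by exists (Some j), s; rewrite /= eqxx s0 st.
exists None, (s - t); rewrite /= subrKC; split => //.
by rewrite subr_ge0 (ltW st) lerD2r.
Qed.

Let proj (x : option E * R) : E * R :=
  if x.1 is Some e then (e, x.2) else (j, t + x.2).

Let valid (x : option E * R) := 0 <= x.2 <= sub_len x.1.

Let proj_valid e' s : 0 <= s <= sub_len e' ->
  0 <= (proj (e', s)).2 <= len M (proj (e', s)).1.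
Proof.
have /andP[t0 tl] := ht.
case: e' => [e|] /= /andP[s0 sl].
  rewrite s0 /=; case: eqVneq sl => // -> h; exact: le_trans h (ltW tl).
by rewrite addr_ge0 ?(ltW t0) //= -lerBrDl.
Qed.

Let chain_proj x y r :
  chain sub_graph sub_len x y r -> chain M (len M) (proj x) (proj y) r.
Proof.
elim=> {x y r} [x|e s u y r hs hu _ IH|x y z r v hx hy _ IH].
- exact: chain_refl.
- move: (proj_valid hs) (proj_valid hu) IH; case: e {hs hu} => [e|] /= hs hu IH.
    exact: chain_segment.
  have -> : `|s - u| = `|(t + s) - (t + u)| by rewrite opprD addrACA subrr add0r.
  exact: chain_segment.
case: v hx hy => [v|] hx hy.
  have lift w : at_vertex sub_graph sub_len w (Some v) -> at_vertex M (len M) (proj w) v.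
    case: w => [[e|] s] [] /= [] /= -> //.
    - by case=> <-; left.
    - by case: ifP => // _ [<-]; right.
    - by case=> <-; right; rewrite /= subrKC.
  exact: chain_glue (lift _ hx) (lift _ hy) IH.
suff new w : at_vertex sub_graph sub_len w None -> proj w = (j, t).
  by rewrite (new _ hx) -(new _ hy).
case: w => [[e|] s] [] /= [] /= -> //.
- by case: eqVneq => // ->.
- by rewrite /proj /= addr0.
Qed.

Let new_glue1 : at_vertex sub_graph sub_len (Some j, t) None.
Proof. by right; rewrite /= eqxx. Qed.

Let new_glue2 : at_vertex sub_graph sub_len (None, 0) None.
Proof. by left. Qed.

Let same_proj x y : valid x -> valid y -> proj x = proj y ->
  chain sub_graph sub_len x y 0.
Proof.
case: x y => [[e|] s] [[f|] u]; rewrite /valid /= => /andP[s0 sl] /andP[u0 ul].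
- by case=> -> ->; exact: chain_refl.
- case=> ej es; move: sl; rewrite ej eqxx => sl.
  have u00 : u = 0 by apply/eqP; rewrite eq_le u0 andbT -(lerD2l t) addr0 -es.
  have -> : s = t by rewrite es u00 addr0.
  rewrite u00; exact: chain_glue new_glue1 new_glue2 (chain_refl _ _ _).
- case=> ej es; move: ul; rewrite -ej eqxx => ul.
  have s00 : s = 0 by apply/eqP; rewrite eq_le s0 andbT -(lerD2l t) addr0 es.
  have -> : u = t by rewrite -es s00 addr0.
  rewrite s00; exact: chain_glue new_glue2 new_glue1 (chain_refl _ _ _).
- by case=> /addrI ->; exact: chain_refl.
Qed.

Let lift_segment e s u x : 0 <= s <= len M e -> 0 <= u <= len M e ->
  valid x -> proj x = (e, s) ->
  exists y, [/\ valid y, proj y = (e, u) & forall z r,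
    chain sub_graph sub_len y z r ->
    chain sub_graph sub_len x z (`|s - u| + r)].
Proof.
have /andP[t0 tl] := ht.
case: x => [[f|] a]; rewrite /valid /= => /andP[s0 sl] /andP[u0 ul] /andP[a0 al].
  case=> fe ae; subst f a; have [ej|ej] := eqVneq e j; last first.
    exists (Some e, u); rewrite /= (negPf ej) u0 ul; split=> // z r.
    by apply: chain_segment; rewrite /= (negPf ej) ?s0 ?u0.
  subst e; rewrite eqxx in al; have [ut|ut] := leP u t.
    exists (Some j, u); rewrite /= eqxx u0 ut; split=> // z r.
    by apply: chain_segment; rewrite /= eqxx ?s0 ?u0.
  exists (None, u - t); rewrite /proj /= subrKC subr_ge0 (ltW ut) lerD2r.
  split=> // z r h.
  have -> : `|s - u| + r = `|s - t| + (`|0 - (u - t)| + r).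
    rewrite addrA; congr (_ + r).
    have su : s <= u := le_trans al (ltW ut).
    rewrite sub0r opprB [`|s - u|]distrC [`|s - t|]distrC [`|t - u|]distrC.
    by rewrite !ger0_norm ?subr_ge0 ?(ltW ut) // addrC addrA subrK.
  apply: chain_segment; rewrite /= ?eqxx ?s0 ?al ?lexx ?(ltW t0) //.
  apply: chain_glue new_glue1 new_glue2 _.
  by apply: chain_segment => //=; rewrite ?lexx ?subr_ge0 ?(ltW tl) ?(ltW ut) ?lerD2r.
case=> je se; subst e s.
have [ut|ut] := leP u t; last first.
  exists (None, u - t); rewrite /proj /= subrKC subr_ge0 (ltW ut) lerD2r.
  split=> // z r h.
  have -> : `|t + a - u| = `|a - (u - t)| by rewrite opprB [t + a]addrC addrA.
  by apply: chain_segment => //=; rewrite ?a0 ?al ?subr_ge0 ?(ltW ut) ?lerD2r.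
exists (Some j, u); rewrite /= eqxx u0 ut; split=> // z r h.
have -> : `|t + a - u| + r = `|a - 0| + (`|t - u| + r).
  rewrite addrA; congr (_ + r).
  rewrite subr0 (ger0_norm a0) (ger0_norm (x := t - u)) ?subr_ge0 //.
  rewrite ger0_norm ?subr_ge0; first by rewrite addrA [a + t]addrC.
  by rewrite ler_wpDr.
apply: chain_segment => //=; rewrite ?a0 ?al ?lexx ?subr_ge0 ?(ltW tl) //.
apply: chain_glue new_glue2 new_glue1 _.
by apply: chain_segment; rewrite /= ?eqxx ?lexx ?(ltW t0) ?u0.
Qed.

Let chain_lift x y r : chain M (len M) x y r ->
  forall x' y', valid x' -> valid y' -> proj x' = x -> proj y' = y ->
  chain sub_graph sub_len x' y' r.
Proof.
have /andP[t0 tl] := ht.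
elim=> {x y r} [x|e s u y r hs hu _ IH|x y z r v hx hy _ IH] x' y' vx' vy' ex ey.
- by apply: same_proj => //; rewrite ex.
- have [z [vz ez hz]] := lift_segment hs hu vx' ex.
  by apply: hz; exact: IH.
have vertex_valid w' : at_vertex sub_graph sub_len w' (Some v) -> valid w'.
  by case: w' => e' s [] [/= -> _]; rewrite /valid /= lexx ltW // sub_len_gt0.
have [w' hw' ew'] : exists2 w', at_vertex sub_graph sub_len w' (Some v) & proj w' = y.
  case: y hy {IH} => e s [] [/= -> <-]; first by exists (Some e, 0) => //; left.
  have [ej|ej] := eqVneq e j; last first.
    by exists (Some e, len M e) => //; right; rewrite /= (negPf ej).
  by exists (None, len M j - t); [right; rewrite /= ej | rewrite /proj /= subrKC ej].
suff hx' : at_vertex sub_graph sub_len x' (Some v).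
  by apply: (chain_glue hx' hw'); apply: IH => //; exact: vertex_valid hw'.
move: vx' hx; rewrite -ex; case: x' {ex} => [[e|] s]; rewrite /valid /= => /andP[s0 sl] [] [/= hs hv].
- by left; rewrite /= hv.
- have [ej|ej] := eqVneq e j; last by right; rewrite /= (negPf ej) hv.
  by move: sl; rewrite hs ej eqxx leNgt tl.
- by move: t0; rewrite -[t](addrK s) hs sub0r oppr_gt0 ltNge s0.
- by right; rewrite /= hv; split=> //; rewrite -hs addrC addKr.
Qed.

Lemma sub_chart_isom e s f u : 0 <= s <= sub_len e -> 0 <= u <= sub_len f ->
  mdist (sub_chart e s) (sub_chart f u) =
  glued_dist sub_graph sub_len (e, s) (f, u).
Proof.
move=> hs hu.
have -> : glued_dist sub_graph sub_len (e, s) (f, u) =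
          glued_dist M (len M) (proj (e, s)) (proj (f, u)).
  rewrite /glued_dist; congr inf; apply/funext => r; apply/propext; split.
    exact: chain_proj.
  by move/chain_lift; apply.
have := proj_valid hs; have := proj_valid hu.
by case: e {hs} => [e|]; case: f {hu} => [f|] /= hu hs; rewrite chart_isom.
Qed.

Definition subdivide : model Gam (option V) (option E) :=
  {| mgraph := sub_graph; len := sub_len; vpt := sub_vpt; chart := sub_chart;
     len_gt0 := sub_len_gt0; mgraph_connected := sub_connected;
     mgraph_valence := sub_valence; chart_tail := sub_chart_tail;
     chart_head := sub_chart_head; chart_surj := sub_chart_surj;
     chart_isom := sub_chart_isom |}.

(* The edge of the original graph that contains a given edge. *)
Definition parent_edge (e' : option E) : E := odflt j e'.

End Subdivide.

(* Main.v *)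
(** The fundamental cycles and tree paths are determined, as 1-chains, by their
    boundary and by their values outside the tree, since a cycle supported on a
    tree vanishes.  Subdividing an edge induces a pullback of chains that
    preserves boundaries and the length pairing, so it carries the fundamental
    cycles and the paths to the old vertices of G to those of G'.  The path to
    the new vertex is the pulled back path to an endpoint of e_j plus or minus
    one half of e_j, and all formulas follow by pairing it with the cycles.
    That the new vertex sits at the position theta * len e_j uses that the chart
    of an edge is injective on its interior. *)

Require Import Defs.
From HB Require Import structures.
From mathcomp Require Import all_boot all_order all_algebra.
From mathcomp Require Import boolp classical_sets reals topology.
From mathcomp Require Import ring lra.
Set Implicit Arguments.
Unset Strict Implicit.
Unset Printing Implicit Defensive.
Import Order.TTheory GRing.Theory Num.Theory.
Local Open Scope ring_scope.

Lemma big_option (S : nmodType) (T : finType) (F : option T -> S) :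
  \sum_x F x = F None + \sum_x F (Some x).
Proof.
rewrite (bigD1 None) //=; congr (_ + _).
rewrite (reindex_omap Some id) /=; last by case.
by apply: eq_bigl => x; rewrite eqxx.
Qed.

(** * Chains and their boundaries *)

Section Chains.
Variables (R : realType) (V E : finType) (G : digraph V E).
Implicit Types (a b : E -> R) (T : {set E}).

(* The boundary of [a] is [v - u], tested against all functions on vertices. *)
Definition has_boundary a (u v : V) : Prop := forall f : V -> R,
  \sum_e a e * (f (edge_head G e) - f (edge_tail G e)) = f v - f u.

Lemma has_boundaryD a b u v w :
  has_boundary a u v -> has_boundary b v w -> has_boundary (a \+ b) u w.
Proof.
move=> ha hb f; under eq_bigr do rewrite mulrDl.
by rewrite big_split /= ha hb addrC addrA subrK.
Qed.

Lemma has_boundaryN a u v : has_boundary a u v -> has_boundary (\- a) v u.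
Proof.
by move=> ha f; under eq_bigr do rewrite mulNr; rewrite sumrN ha opprB.
Qed.

(** With equal endpoints the condition only says that the boundary is zero, so a closed chain has no
    preferred base point. *)
Lemma has_boundary_loop a u v : has_boundary a u u -> has_boundary a v v.
Proof. by move=> ha f; rewrite ha !subrr. Qed.

Definition edge_chain (e : E) : E -> R := fun e' => (e' == e)%:R.

Lemma edge_chain_boundary e :
  has_boundary (edge_chain e) (edge_tail G e) (edge_head G e).
Proof.
move=> f; rewrite (bigD1 e) //= /edge_chain eqxx mul1r big1 ?addr0 // => e' ne.
by rewrite (negPf ne) mul0r.
Qed.

Lemma coef_cons (s : E * bool) w e :
  coef R (s :: w) e = (if s.2 then edge_chain s.1 e else - edge_chain s.1 e)
                      + coef R w e.
Proof.
rewrite /coef /edge_chain big_cons eq_sym.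
by case: eqVneq => _; case: s.2; rewrite ?oppr0 ?add0r.
Qed.

(** The boundaries of the signed steps telescope along the walk; a backward step contributes the
    negative of its edge. *)
Lemma coef_boundary T u w v : walk G T u w v -> has_boundary (coef R w) u v.
Proof.
elim: w u => [|[e d] w IH] u /=.
  by move/eqP=> -> f; rewrite subrr big1 // => e _; rewrite /coef big_nil mul0r.
case/and3P=> _ /eqP <- /IH; rewrite /step_src /step_dst => hw f.
under eq_bigr do rewrite coef_cons.
case: d hw => /= hw; first exact: has_boundaryD (edge_chain_boundary e) hw f.
exact: has_boundaryD (has_boundaryN (edge_chain_boundary e)) hw f.
Qed.

Lemma coef_supp T u w v e : walk G T u w v -> e \notin T -> coef R w e = 0.
Proof.
move=> + eT; elim: w u => [|s w IH] u /=; first by rewrite /coef big_nil.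
case/and3P=> sT _ /IH hw; rewrite coef_cons hw /edge_chain.
have /negPf -> : e != s.1 by apply: contraNneq eT => ->.
by rewrite oppr0 if_same addr0.
Qed.

(* The path matrix of a tree is a right inverse, hence also a left inverse, of
   its reduced incidence matrix, so a cycle supported on a tree vanishes. *)
Lemma tree_chain_unique n (vs : 'I_n.+1 -> V) (ts : 'I_n -> E) a b u v :
    injective vs -> injective ts -> spans G [set ts i | i in 'I_n]%SET ->
    has_boundary a u v -> has_boundary b u v ->
    (forall e, e \notin [set ts i | i in 'I_n]%SET -> a e = b e) ->
  a =1 b.
Proof.
move=> vsI tsI; set T := [set _ | _ in _]%SET => spT ha hb ab.
(* Sums against a chain supported on the tree become sums over the indices of tree edges, the form
   needed for matrix products. *)
have sumT (c F : E -> R) : (forall e, e \notin T -> c e = 0) ->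
    \sum_e c e * F e = \sum_i c (ts i) * F (ts i).
  move=> c0; rewrite (bigID (mem T)) /= [X in _ + X]big1 ?addr0; last first.
    by move=> e /c0 ->; rewrite mul0r.
  by rewrite big_imset //= => x y _ _; exact: tsI.
(* Indicators of the non-root vertices serve as test functions; leaving out the root makes the
   incidence matrix [B] square. *)
pose ind (i : 'I_n) x : R := (x == vs (lift ord0 i))%:R.
pose B : 'M[R]_n :=
  \matrix_(l, i) (ind i (edge_head G (ts l)) - ind i (edge_tail G (ts l))).
(* Any walks from the root within the tree will do, since only their boundaries and supports are
   used. *)
have /choice[p hp] (i : 'I_n) := spT (vs ord0) (vs (lift ord0 i)).
pose Y : 'M[R]_n := \matrix_(i, l) coef R (p i) (ts l).
have YB : Y *m B = 1%:M.
  apply/matrixP => i i'; rewrite !mxE; under eq_bigr do rewrite !mxE.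
  rewrite -(sumT (coef R (p i))
    (fun e => ind i' (edge_head G e) - ind i' (edge_tail G e))); last first.
    by move=> e; exact: coef_supp (hp i).
  rewrite (coef_boundary (hp i)) /ind !(inj_eq vsI) (inj_eq lift_inj).
  by rewrite -[_ == lift _ _]negbK neq_lift subr0.
pose c e := a e - b e.
have c0 e : e \notin T -> c e = 0 by move=> /ab abe; rewrite /c abe subrr.
have cB : (\row_l c (ts l)) *m B = 0.
  apply/matrixP => i i'; rewrite !mxE; under eq_bigr do rewrite !mxE.
  rewrite -(sumT c (fun e => ind i' (edge_head G e) - ind i' (edge_tail G e))) //.
  by under eq_bigr do rewrite mulrBl; rewrite sumrB ha hb subrr.
have cts l : c (ts l) = 0.
  have : \row_l c (ts l) = 0.
    by rewrite -[LHS]mulmx1 -(mulmx1C YB) mulmxA cB mul0mx.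
  by move/rowP/(_ l); rewrite !mxE.
move=> e; apply/eqP; rewrite -subr_eq0; apply/eqP; rewrite -/(c e).
by have [/imsetP[l _ ->]|/c0] := boolP (e \in T).
Qed.

(** * Simple paths inside walks *)

Lemma simple_path_suffix T u w v x :
  simple_path G T u w v -> x \in u :: map (step_dst G) w ->
  exists w', simple_path G T x w' v.
Proof.
elim: w u => [|s w IH] u /=.
  by move=> hu; rewrite inE => /eqP ->; exists [::].
move=> hp; rewrite inE => /orP[/eqP ->|]; first by exists (s :: w).
apply: IH; case/andP: hp => /and3P[_ _ hw] /= /and3P[_ h1 h2].
by apply/andP; split=> //=; rewrite h1.
Qed.

(** Loop erasure: if the start vertex is visited again by the simple path obtained for the rest, the
    suffix from that visit is kept instead. *)
Lemma walk_simple T u w v :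
  walk G T u w v -> exists w', simple_path G T u w' v.
Proof.
elim: w u => [|s w IH] u /=; first by move/eqP=> ->; exists [::]; rewrite /simple_path /= eqxx.
case/and3P=> sT su /IH[w' hw'].
have [uin|un] := boolP (u \in step_dst G s :: map (step_dst G) w').
  exact: simple_path_suffix hw' uin.
exists (s :: w'); case/andP: hw' => hw' uw'.
apply/andP; split; first exact/and3P.
by rewrite map_cons cons_uniq un.
Qed.

(** A spanning set contains a simple path, so [tree_path] is not its dummy value. *)
Lemma tree_path_walk T u v : spans G T -> walk G T u (tree_path G T u v) v.
Proof.
move=> spT; have [w /walk_simple[w' hw']] := spT u v.
suff /andP[] : simple_path G T u (tree_path G T u v) v by [].
by apply: (@xgetPex _ [::] (fun w => simple_path G T u w v : Prop)); exists w'.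
Qed.

(** * The length pairing, and the output of the algorithm in terms of it *)

Definition pairing (len a b : E -> R) : R := \sum_e a e * len e * b e.

Section Algorithm.
Variables (len : E -> R) (k g : nat) (vs : 'I_k.+1 -> V) (es : 'I_(k + g) -> E).
Hypotheses (es_bij : bijective es) (sp : spans G (tree_edges es)).

Definition path_chain i := coef R (root_path G vs es i).
Definition cycle_chain i := coef R (fund_cycle G es i).

Lemma path_chain_boundary i : has_boundary (path_chain i) (vs ord0) (vs i).
Proof. exact: coef_boundary (tree_path_walk _ _ sp). Qed.

Lemma path_chain_supp i e : e \notin tree_edges es -> path_chain i e = 0.
Proof. exact: coef_supp (tree_path_walk _ _ sp). Qed.

Lemma cycle_chain_boundary i u : has_boundary (cycle_chain i) u u.
Proof.
apply: has_boundary_loop; move=> f.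
under eq_bigr do rewrite /cycle_chain coef_cons /=.
exact: has_boundaryD (edge_chain_boundary _)
  (coef_boundary (tree_path_walk _ _ sp)) f.
Qed.

Lemma cycle_chain_supp i e : e \notin tree_edges es ->
  cycle_chain i e = (e == es (rshift k i))%:R.
Proof.
move=> eT; rewrite /cycle_chain coef_cons /=.
by rewrite (coef_supp (tree_path_walk _ _ sp) eT) addr0.
Qed.

Lemma pairing_mx m n (A : 'M[R]_(m, k + g)) (B : 'M_(n, k + g)) i i' a b :
    (forall l, A i l = a (es l)) -> (forall l, B i' l = b (es l)) ->
  (A *m Lmx len es *m B^T) i i' = pairing len a b.
Proof.
move=> hA hB; rewrite /pairing (reindex es) /=; last exact: onW_bij.
by rewrite /Lmx mul_mx_diag mxE; apply: eq_bigr => l _; rewrite !mxE hA hB.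
Qed.

Lemma Vmx_pairing i i' :
  Vmx G len vs es i i' = pairing len (cycle_chain i) (path_chain i').
Proof. by apply: pairing_mx => l; rewrite mxE. Qed.

Lemma Qmx_pairing i i' :
  Qmx G len es i i' = pairing len (cycle_chain i) (cycle_chain i').
Proof. by apply: pairing_mx => l; rewrite mxE. Qed.

Lemma notin_tree_edges e :
  e \notin tree_edges es -> exists i, e = es (rshift k i).
Proof.
have [es' _ esK] := es_bij => eT; rewrite -(esK e); move: eT; rewrite -{1}(esK e).
case: (split_ordP (es' e)) => i -> eT; last by exists i.
by case/negP: eT; apply/imsetP; exists i.
Qed.

Lemma rshift_notin_tree_edges i : es (rshift k i) \notin tree_edges es.
Proof.
apply/imsetP => -[l _ /(bij_inj es_bij) /eqP].
by rewrite eq_sym eq_lrshift.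
Qed.

Lemma pairingDr a b c : pairing len a (b \+ c) = pairing len a b + pairing len a c.
Proof. by rewrite -big_split; apply: eq_bigr => e _; rewrite mulrDr. Qed.

Lemma pairingNr a b : pairing len a (\- b) = - pairing len a b.
Proof. by rewrite -sumrN; apply: eq_bigr => e _; rewrite mulrN. Qed.

Lemma pairing_edge a e : pairing len a (edge_chain e) = a e * len e.
Proof.
rewrite /pairing (bigD1 e) //= big1 /edge_chain ?eqxx ?addr0 ?mulr1 // => e' ne.
by rewrite (negPf ne) mulr0.
Qed.

End Algorithm.
End Chains.

(** * Charts are injective on open edges *)

(* A function on the edges that is 1-Lipschitz on each of them and vanishes at
   the vertices descends to a 1-Lipschitz function for the glued distance. *)
Lemma chain_lipschitz (R : realType) (V E : finType) (G : digraph V E)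
    (len : E -> R) (f : E * R -> R) :
    (forall e s t, `|f (e, s) - f (e, t)| <= `|s - t|) ->
    (forall x v, at_vertex G len x v -> f x = 0) ->
  forall x y r, chain G len x y r -> `|f x - f y| <= r.
Proof.
move=> lip f0 x y r; elim=> {x y r} [x|e s t y r _ _ _ IH|x y z r v hx hy _ IH].
- by rewrite subrr normr0.
- apply: le_trans (lerD (lip e s t) IH).
  exact: ler_distD.
- by rewrite (f0 _ _ hx) -(f0 _ _ hy).
Qed.

(** A tent function centred at [s] and vanishing at the vertices is 1-Lipschitz for the glued
    distance. If both points coincide, its value at [t] is at least its peak, which is attained only
    at [s]. *)
Lemma chart_inj (R : realType) (Gam : metricType R) (V E : finType)
    (G : model Gam V E) e s t :
  0 < s < len G e -> 0 < t < len G e -> chart G e s = chart G e t -> s = t.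
Proof.
move=> /andP[s0 sl] /andP[t0 tl] st; apply/eqP; apply: contraTT isT => nst.
have hs : 0 <= s <= len G e by rewrite !ltW.
have ht : 0 <= t <= len G e by rewrite !ltW.
have := chart_isom hs ht; rewrite st mdistxx => d0.
(* The height is the distance from [s] to the nearer end of the edge, so that the tent of slope one
   reaches zero at both ends. *)
pose c := Num.min s (len G e - s).
have c_gt0 : 0 < c by rewrite lt_min s0 subr_gt0.
pose bump x := if x.1 == e then Num.max 0 (c - `|x.2 - s|) else 0.
have lip f u v : `|bump (f, u) - bump (f, v)| <= `|u - v|.
  rewrite /bump /=; case: eqP => _; last by rewrite subrr normr0.
  (* Together these two triangle inequalities bound the difference of the distances of [u] and [v]
     to [s] by their mutual distance. *)
  have := ler_normB (u - s) (u - v); have := ler_normB (v - s) (v - u).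
  rewrite [`|v - u|]distrC.
  have -> : u - s - (u - v) = v - s by lra.
  have -> : v - s - (v - u) = u - s by lra.
  move=> h1 h2; rewrite ler_norml.
  have := normr_ge0 (u - v).
  case: (leP 0 (c - `|u - s|)) => ?; case: (leP 0 (c - `|v - s|)) => ? ?;
    apply/andP; split; lra.
have bump0 x v : at_vertex G (len G) x v -> bump x = 0.
  case: x => f u; rewrite /bump /c => -[] [] /= -> _; case: eqP => // fe.
    rewrite sub0r normrN (gtr0_norm s0); apply/max_idPl.
    by rewrite subr_le0 ge_min lexx.
  rewrite fe (gtr0_norm (x := len G e - s)) ?subr_gt0 //; apply/max_idPl.
  by rewrite subr_le0 ge_min lexx orbT.
have : bump (e, s) - bump (e, t) <= 0.
  rewrite d0; apply: lb_le_inf.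
    (* The direct segment shows that the set of chain lengths is nonempty, so its infimum is a
       genuine one. *)
    exists (`|s - t| + 0); apply: chain_segment => //; exact: chain_refl.
  move=> r /= /(chain_lipschitz lip bump0); apply: le_trans; exact: ler_norm.
rewrite /bump /= eqxx subrr normr0 subr0 (max_idPr (ltW c_gt0)) subr_le0.
have : 0 < `|t - s| by rewrite normr_gt0 subr_eq0 eq_sym.
by rewrite le_max [c <= 0]leNgt c_gt0 /=; lra.
Qed.

(** * Pulling chains back to a subdivision *)

Section Pullback.
Variables (R : realType) (Gam : metricType R) (V E : finType).
Variables (G : model Gam V E) (j : E) (t : R).
Implicit Types a b : E -> R.

Definition pullback a : option E -> R := a \o parent_edge j.

(** Both halves of [j] carry the same coefficient, so their contributions at the new vertex
    cancel. *)
Lemma pullback_boundary a u v : has_boundary G a u v ->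
  has_boundary (sub_graph G j) (pullback a) (Some u) (Some v).
Proof.
move=> ha f; rewrite -(ha (f \o Some)) big_option /= /pullback /=.
rewrite [in LHS](bigD1 j) // [in RHS](bigD1 j) //= eqxx addrA -mulrDr.
congr (_ * _ + _); first by rewrite addrA subrK.
by apply: eq_bigr => e ne; rewrite (negPf ne).
Qed.

(** The lengths of the two halves add up to the length of [j]. *)
Lemma pairing_pullback a b :
  pairing (sub_len G j t) (pullback a) (pullback b) = pairing (len G) a b.
Proof.
rewrite /pairing big_option /= /pullback /=.
rewrite [in LHS](bigD1 j) // [in RHS](bigD1 j) //= eqxx addrA -mulrDl -mulrDr subrK.
by congr (_ + _); apply: eq_bigr => e ne; rewrite (negPf ne).
Qed.

End Pullback.

Theorem theorem4p5 (R : realType) (Gam : metricType R) (V E : finType)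
    (G : model Gam V E) (k g : nat)
    (vs : 'I_k.+1 -> V) (es : 'I_(k + g) -> E)
    (vs_bij : bijective vs) (es_bij : bijective es)
    (ST_tree : spanning_tree G (tree_edges es))
    (j : 'I_(k + g)) (t : R) (ht : 0 < t < len G (es j))
    (theta : R) (theta01 : 0 < theta < 1)
    (new_percentile :
      percentile_point G (es j) theta (vpt (subdivide ht) None))
    (vs' : 'I_k.+2 -> option V) (es' : 'I_(k.+1 + g) -> option E)
    (vs'_old : forall i : 'I_k.+1, vs' (widen_ord (leqnSn k.+1) i) = Some (vs i))
    (vs'_new : vs' ord_max = None)
    (es'_bij : bijective es')
    (ST'_tree : spanning_tree (subdivide ht) (tree_edges es'))
    (ST'_old : forall e : E, e != es j ->
      (Some e \in tree_edges es') = (e \in tree_edges es))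
    (es'_order : forall i : 'I_g,
      parent_edge (es j) (es' (rshift k.+1 i)) = es (rshift k i)) :
  let Vm := Vmx G (len G) vs es in
  let Qm := Qmx G (len G) es in
  let Vm' := Vmx (subdivide ht) (len (subdivide ht)) vs' es' in
  let Qm' := Qmx (subdivide ht) (len (subdivide ht)) es' in
  Qm' = Qm /\
  (forall jm jp : 'I_k.+1,
    vs jm = edge_tail G (es j) -> vs jp = edge_head G (es j) ->
    (es j \in tree_edges es ->
      (forall i : 'I_k.+1, col (widen_ord (leqnSn k.+1) i) Vm' = col i Vm) /\
      col ord_max Vm' = (1 - theta) *: col jm Vm + theta *: col jp Vm) /\
    (es j \notin tree_edges es ->
      let w : 'cV[R]_g :=
        \col_i (if rshift k i == j then len G (es j) else 0) in
      (forall i : 'I_k.+1, col (widen_ord (leqnSn k.+1) i) Vm' = col i Vm) /\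
      ([/\ Some (es j) \in tree_edges es', None \notin tree_edges es' &
           col ord_max Vm' = col jm Vm + theta *: w] \/
       [/\ Some (es j) \notin tree_edges es', None \in tree_edges es' &
           col ord_max Vm' = col jp Vm - (1 - theta) *: w]))).
Proof.
have [[spT _] [spT' _]] := (ST_tree, ST'_tree).
have t_def : t = theta * len G (es j).
  have [s [hs st <-]] := new_percentile.
  exact: chart_inj ht hs st.
have vsI := bij_inj vs_bij.
have vs'I : injective vs'.
  have vs'P i : i = ord_max \/ exists i0, i = widen_ord (leqnSn k.+1) i0.
    have [ik|ki] := ltnP i k.+1; [right|left].
      by exists (Ordinal ik); apply: val_inj.
    by apply: val_inj; apply: anti_leq; rewrite ki /= -ltnS ltn_ord.
  move=> x y; case: (vs'P x) => [->|[x0 ->]]; case: (vs'P y) => [->|[y0 ->]] //;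
    rewrite ?vs'_old ?vs'_new //.
  by case=> /vsI ->.
have lsI n : injective (@lshift n g) := @lshift_inj n g.
have uniqT := tree_chain_unique (R := R) vsI (inj_comp (bij_inj es_bij) (@lsI k)) spT.
have uniqT' := tree_chain_unique (R := R) vs'I (inj_comp (bij_inj es'_bij) (@lsI k.+1)) spT'.
(* By [es'_order], each chord of the subdivision lies over the chord of the original graph with the
   same index. *)
have notinT' e' : e' \notin tree_edges es' ->
    exists2 i, e' = es' (rshift k.+1 i) & parent_edge (es j) e' = es (rshift k i).
  by move=> /(notin_tree_edges es'_bij)[i ->]; exists i.
have parent_notinT e' : e' \notin tree_edges es' ->
    parent_edge (es j) e' \notin tree_edges es.
  by case/notinT' => i _ ->; exact: rshift_notin_tree_edges.
pose sigma := cycle_chain R G es; pose gamma := path_chain R G vs es.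
pose sigma' := cycle_chain R (subdivide ht) es'.
pose gamma' := path_chain R (subdivide ht) vs' es'.
have sigmaE i : sigma' i =1 pullback (es j) (sigma i).
  (* The base vertex is arbitrary because both chains are closed. Off the tree, each is the
     indicator of the chord of index [i]. *)
  apply: (uniqT' _ _ None None).
  - exact: cycle_chain_boundary.
  - by apply: has_boundary_loop; apply: pullback_boundary;
      exact: cycle_chain_boundary spT _ (vs ord0).
  - move=> e' eT; rewrite /pullback /= /sigma /sigma' !cycle_chain_supp //.
      have [i' -> ->] := notinT' _ eT.
      by rewrite (inj_eq (bij_inj es_bij)) (inj_eq (bij_inj es'_bij)) !eq_rshift.
    exact: parent_notinT.
have root' : vs' ord0 = Some (vs ord0).
  by rewrite -vs'_old; congr (vs' _); apply: val_inj.
have pull_supp i e' : e' \notin tree_edges es' -> pullback (es j) (gamma i) e' = 0.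
  by move=> /parent_notinT; exact: path_chain_supp.
have gammaE i : gamma' (widen_ord (leqnSn k.+1) i) =1 pullback (es j) (gamma i).
  apply: (uniqT' _ _ (vs' ord0) (Some (vs i))).
  - by rewrite -vs'_old; exact: path_chain_boundary.
  - by rewrite root'; apply: pullback_boundary; exact: path_chain_boundary.
  - by move=> e' eT; rewrite pull_supp //; exact: path_chain_supp.
(* The path to the new vertex need not be computed: any chain with its boundary and supported on the
   new tree represents it. *)
have gamma_new (c : option E -> R) : has_boundary (subdivide ht) c (Some (vs ord0)) None ->
    (forall e', e' \notin tree_edges es' -> c e' = 0) -> gamma' ord_max =1 c.
  move=> hc c0; apply: (uniqT' _ _ (vs' ord0) None); last 1 first.
  - by move=> e' eT; rewrite c0 //; exact: path_chain_supp.
  - by rewrite -vs'_new; exact: path_chain_boundary.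
  - by rewrite root'.
move=> Vm Qm Vm' Qm'.
have VmE i x : Vm i x = pairing (len G) (sigma i) (gamma x).
  exact: Vmx_pairing.
have Vm'E i x c : gamma' x =1 c ->
    Vm' i x =
    pairing (sub_len G (es j) t) (pullback (es j) (sigma i)) c.
  move=> hc; rewrite /Vm' Vmx_pairing //.
  by apply: eq_bigr => e _; congr (_ * _ * _); [exact: sigmaE|exact: hc].
have QmE : Qm' = Qm.
  apply/matrixP => i i'; rewrite !Qmx_pairing // -(pairing_pullback G (es j) t).
  by apply: eq_bigr => e _; congr (_ * _ * _); exact: sigmaE.
clearbody Vm Vm'.
have Vm'_old i : col (widen_ord (leqnSn k.+1) i) Vm' = col i Vm.
  by apply/colP => x; rewrite !mxE (Vm'E _ _ _ (gammaE i)) VmE pairing_pullback.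
split=> // jm jp jmE jpE.
(* First candidate: go to the initial vertex of [es j], then forwards along the first half. *)
pose c1 := pullback (es j) (gamma jm) \+ edge_chain R (Some (es j)).
have c1B : has_boundary (subdivide ht) c1 (Some (vs ord0)) None.
  apply: (@has_boundaryD _ _ _ _ _ _ _ (Some (vs jm))).
    by apply: pullback_boundary; exact: path_chain_boundary.
  have := edge_chain_boundary (R := R) (sub_graph G (es j)) (Some (es j)).
  by rewrite /= eqxx jmE.
(* Second candidate: go to the terminal vertex of [es j], then backwards along the second half. *)
pose c2 := pullback (es j) (gamma jp) \+ (\- edge_chain R (@None E)).
have c2B : has_boundary (subdivide ht) c2 (Some (vs ord0)) None.
  apply: (@has_boundaryD _ _ _ _ _ _ _ (Some (vs jp))).
    by apply: pullback_boundary; exact: path_chain_boundary.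
  apply: has_boundaryN; rewrite jpE.
  exact: (edge_chain_boundary (R := R) (sub_graph G (es j)) None).
have edge_supp (e e' : option E) : e \in tree_edges es' -> e' \notin tree_edges es' ->
    edge_chain R e e' = 0.
  by move=> eT e'T; rewrite /edge_chain; case: eqVneq e'T => // ->; rewrite eT.
have V1 i : Some (es j) \in tree_edges es' ->
    Vm' i ord_max = Vm i jm + sigma i (es j) * t.
  move=> jT; rewrite (Vm'E _ _ c1) ?VmE ?pairingDr ?pairing_pullback ?pairing_edge.
    by rewrite /= eqxx.
  by apply: gamma_new => // e' eT; rewrite /c1 /= pull_supp // edge_supp // addr0.
have V2 i : None \in tree_edges es' ->
    Vm' i ord_max = Vm i jp - sigma i (es j) * (len G (es j) - t).
  move=> jT; rewrite (Vm'E _ _ c2) ?VmE ?pairingDr ?pairingNr ?pairing_pullback ?pairing_edge //.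
  by apply: gamma_new => // e' eT; rewrite /c2 /= pull_supp // edge_supp // oppr0 addr0.
split=> [jT|jNT].
  split=> //.
  (* An equality of chains, not of paths: if the path to [jm] already runs through [es j], it does
     so backwards, and the added edge cancels it. *)
  have gammaJ : gamma jp =1 gamma jm \+ edge_chain R (es j).
    apply: (uniqT _ _ (vs ord0) (vs jp)).
    - exact: path_chain_boundary.
    - apply: (@has_boundaryD _ _ _ _ _ _ _ (vs jm)); first exact: path_chain_boundary.
      by rewrite jmE jpE; exact: edge_chain_boundary.
    - move=> e eT; rewrite /gamma /= !path_chain_supp // /edge_chain add0r.
      by case: eqVneq eT => // ->; rewrite jT.
  have VJ i : Vm i jp = Vm i jm + sigma i (es j) * len G (es j).
    rewrite !VmE -pairing_edge -pairingDr.
    by apply: eq_bigr => e _; rewrite gammaJ.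
  (* Chords lie over chords, so a half of a tree edge belongs to the new tree, and the formula
     through the first half applies. *)
  have jT' : Some (es j) \in tree_edges es'.
    by apply: contraTT jT => /parent_notinT.
  apply/colP => i; rewrite mxE V1 // !mxE VJ t_def; ring.
move=> w; split=> //.
have [i0 jE] := notin_tree_edges es_bij jNT.
(* Since [es j] is a chord, only its own fundamental cycle crosses it; this is the source of the
   vector [w]. *)
have sigmaJ i : sigma i (es j) = (rshift k i == j)%:R.
  by rewrite /sigma cycle_chain_supp // (inj_eq (bij_inj es_bij)) eq_sym.
have halves : (Some (es j) \notin tree_edges es') = (None \in tree_edges es').
  (* [es' (rshift k.+1 i0)] is one of the two halves, and no other chord is. *)
  have [e' [e'T e'j]] : exists e', e' \notin tree_edges es' /\ parent_edge (es j) e' = es j.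
    by exists (es' (rshift k.+1 i0)); rewrite es'_order; split=> //; exact: rshift_notin_tree_edges.
  have chord_unique e1 e2 : e1 \notin tree_edges es' -> e2 \notin tree_edges es' ->
      parent_edge (es j) e1 = parent_edge (es j) e2 -> e1 = e2.
    move=> /notinT'[i1 -> ->] /notinT'[i2 -> ->] /(bij_inj es_bij)/eqP.
    by rewrite eq_rshift => /eqP ->.
  apply/idP/idP => [sT|].
    by apply/negPn/negP => /(chord_unique _ _ sT) /(_ erefl).
  move=> nT; case: e' e'T e'j => [e|] /=; last by rewrite nT.
  by move=> + <-.
have [jT'|jT'] := boolP (Some (es j) \in tree_edges es').
  left; split; rewrite -?halves ?jT' //.
  apply/colP => i; rewrite mxE V1 // !mxE sigmaJ t_def.
  by case: (rshift k i == j); rewrite /=; ring.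
have nT' : None \in tree_edges es' by rewrite -halves.
right; split=> //; apply/colP => i; rewrite mxE V2 // !mxE sigmaJ t_def.
by case: (rshift k i == j); rewrite /=; ring.
Qed.
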